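(* The frustration numbers of the six signed Petersen graphs are $l_0(+P)=0$, $l_0(P_1)=1$, $l_0(P_{2,2})=2$, $l_0(P_{2,3})=2$, $l_0(P_{3,2})=3$, $l_0(P_{3,3})=3$. Every signed Petersen graph has frustration number equal to its frustration index.
   Context: The Petersen graph $P$ has vertices $v_{ij}$ indexed by the 2-element subsets $\{i,j\}$ of $\{1,\dots,5\}$, with $v_{ij}v_{kl}$ an edge iff $\{i,j\}\cap\{k,l\}=\emptyset$. A signed Petersen graph is $(P,\sigma)$ with $\sigma:E(P)\to\{+,-\}$. A signed graph is balanced if every cycle has positive sign product. The frustration index $l$ is the smallest number of edges whose deletion leaves a balanced signed graph; the frustration number $l_0$ is the smallest number of vertices whose deletion leaves a balanced signed graph. Edge distance is distance in the line graph; in $P$ two disjoint edges are at distance 2 if some edge joins an endpoint of one to an endpoint of the other, and at distance 3 otherwise. $+P$: all edges positive; $P_1$: exactly one negative edge; $P_{2,2}$ / $P_{2,3}$: exactly two negative edges at distance 2 / 3; $P_{3,2}$: exactly three negative edges forming alternate edges of a 6-cycle of $P$; $P_{3,3}$: exactly three negative edges pairwise at distance 3. *)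

(* Defs.v *)
From mathcomp Require Import all_boot all_order all_algebra.

Set Implicit Arguments.
Unset Strict Implicit.
Unset Printing Implicit Defensive.

Local Open Scope ring_scope.

(* Throughout, a graph is given by a (symmetric, irreflexive) adjacency
   relation on a finite type. *)
Definition edge (T : finType) (adj : rel T) : finType :=
  {e : {set T} | [exists x, exists y, adj x y && (e == [set x; y])]}.

(* A signature maps an edge to [true] iff that edge is negative. *)
Definition signature (T : finType) (adj : rel T) := edge adj -> bool.

Definition negative_edges (T : finType) (adj : rel T) (sigma : signature adj) :
  {set edge adj} := [set e | sigma e].

Definition is_cycle (T : finType) (adj : rel T) (c : seq T) : bool :=
  (2 < size c)%N && ucycleb adj c.

Definition cycle_edges (T : finType) (adj : rel T) (c : seq T) :
  {set edge adj} := [set e | val e \in [seq [set x; next c x] | x <- c]].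

Definition cycle_sign (T : finType) (adj : rel T) (sigma : signature adj)
  (c : seq T) : int := \prod_(e in cycle_edges adj c) (-1) ^+ sigma e.

(* Balance of the subgraph with vertex set S and edge set F.  The bound on the
   length of c only serves to make this a boolean: see [balancedP]. *)
Definition balanced (T : finType) (adj : rel T) (sigma : signature adj)
  (S : {set T}) (F : {set edge adj}) : bool :=
  [forall n : 'I_#|T|.+1, forall c : n.-tuple T,
     [&& is_cycle adj c, c \subset S & cycle_edges adj c \subset F] ==>
     (cycle_sign sigma c == 1)].

Lemma balancedP (T : finType) (adj : rel T) (sigma : signature adj)
    (S : {set T}) (F : {set edge adj}) :
  reflect (forall c : seq T, is_cycle adj c -> {subset c <= S} ->
             cycle_edges adj c \subset F -> cycle_sign sigma c = 1)
          (balanced sigma S F).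
Proof.
apply: (iffP idP) => [/forallP bal c cyc /subsetP cS cF | bal].
  have /andP[_ /andP[_ /card_uniqP sz]] := cyc.
  have lt_c : (size c < #|T|.+1)%N by rewrite ltnS -sz max_card.
  have /forallP/(_ (in_tuple c)) := bal (Ordinal lt_c).
  by rewrite cyc cF andbT => /implyP/(_ cS)/eqP.
apply/forallP => n; apply/forallP => c; apply/implyP.
by case/and3P => cyc /subsetP cS cF; apply/eqP/bal.
Qed.

Definition balanced_del_edges (T : finType) (adj : rel T)
  (sigma : signature adj) (D : {set edge adj}) : bool :=
  balanced sigma setT (~: D).

Definition balanced_del_vertices (T : finType) (adj : rel T)
  (sigma : signature adj) (W : {set T}) : bool :=
  balanced sigma (~: W) [set e : edge adj | val e \subset ~: W].

(* The minima below are genuine: deleting all edges, or all vertices, leaves no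
   cycle, hence a balanced graph. *)
Definition frustration_index (T : finType) (adj : rel T)
  (sigma : signature adj) : nat :=
  #|[arg min_(D < [set: edge adj] | balanced_del_edges sigma D) #|D| ]%N|.

Definition frustration_number (T : finType) (adj : rel T)
  (sigma : signature adj) : nat :=
  #|[arg min_(W < [set: T] | balanced_del_vertices sigma W) #|W| ]%N|.

Lemma balanced_del_all_edges (T : finType) (adj : rel T)
  (sigma : signature adj) : balanced_del_edges sigma setT.
Proof.
apply/balancedP => c _ _; rewrite setCT subset0 => /eqP c0.
by rewrite /cycle_sign c0 big_set0.
Qed.

Lemma balanced_del_all_vertices (T : finType) (adj : rel T)
  (sigma : signature adj) : balanced_del_vertices sigma setT.
Proof.
apply/balancedP => -[|x c] // _ /(_ x).
by rewrite mem_head setCT inE => /(_ isT).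
Qed.

(* Length of a shortest path; the value is #|T| if y is unreachable. *)
Definition graph_dist (T : finType) (adj : rel T) (x y : T) : nat :=
  find (fun n => [exists p : n.-tuple T, path adj x p && (last x p == y)])
       (iota 0 #|T|).

Definition line_adj (T : finType) (adj : rel T) : rel (edge adj) :=
  fun e f => (e != f) && (val e :&: val f != set0).

Definition edge_dist (T : finType) (adj : rel T) (e f : edge adj) : nat :=
  graph_dist (@line_adj T adj) e f.

Definition petersen_vertex : finType := {A : {set 'I_5} | #|A| == 2%N}.

Definition petersen : rel petersen_vertex :=
  fun A B => [disjoint val A & val B].

Definition all_positive : signature petersen := fun _ => false.

Definition is_P1 (sigma : signature petersen) : Prop :=
  #|negative_edges sigma| = 1%N.

(* P_{2,2} and P_{2,3} are the cases d = 2 and d = 3. *)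
Definition is_P2 (d : nat) (sigma : signature petersen) : Prop :=
  exists e f : edge petersen,
    [/\ e != f, negative_edges sigma = [set e; f] & edge_dist e f = d].

Definition is_P32 (sigma : signature petersen) : Prop :=
  exists v0 v1 v2 v3 v4 v5 : petersen_vertex,
    is_cycle petersen [:: v0; v1; v2; v3; v4; v5] /\
    [set val e | e in negative_edges sigma] =
      [set [set v0; v1]; [set v2; v3]; [set v4; v5]].

Definition is_P33 (sigma : signature petersen) : Prop :=
  #|negative_edges sigma| = 3%N /\
  {in negative_edges sigma &, forall e f, e != f -> edge_dist e f = 3%N}.

(* Main.v *)
Require Import Defs.
From mathcomp Require Import all_boot all_order all_algebra.

(* In a graph of maximum degree 3 the two invariants agree: deleting an endpoint
   of each deleted edge gives one inequality.  For the other, if deleting the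
   vertex set W leaves a balanced graph, switch it to be all positive (Harary)
   and choose the switching on W so as to minimise the number of negative edges;
   then every negative edge meets W, and each vertex of W lies on at most one of
   them, because otherwise switching that vertex would do better.

   It remains to compute frustration indices.  The number of negative edges is an
   upper bound.  Each edge of the Petersen graph lies in exactly 4 of its 12
   pentagons and in exactly 4 of its 10 hexagons, so the index is at least a
   quarter of the number of negative pentagons, and likewise for hexagons.
   These numbers are (4, 4) for P_1, (6, 6) for P_{2,2}, (8, 4) for P_{2,3},
   (6, 10) for P_{3,2} and (12, 0) for P_{3,3}, which gives 1, 2, 2, 3, 3. *)

Set Implicit Arguments.
Unset Strict Implicit.
Unset Printing Implicit Defensive.

Import GRing.Theory.

(** * Switching and balance *)

Section SignedGraph.

Variables (T : finType) (adj : rel T).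
Hypotheses (adj_sym : symmetric adj) (adj_irr : irreflexive adj).
Implicit Types (sigma : signature adj) (X S W : {set T}) (c : seq T).
Implicit Types (e : edge adj) (D F : {set edge adj}).

Lemma adj_edge x y : adj x y -> exists e : edge adj, val e = [set x; y].
Proof.
move=> xy; have ok :
    [exists u, exists v, adj u v && ([set x; y] == [set u; v])].
  by apply/existsP; exists x; apply/existsP; exists y; rewrite xy eqxx.
by exists (Sub [set x; y] ok); rewrite SubK.
Qed.

Lemma edge_adj e : exists x y, adj x y /\ val e = [set x; y].
Proof.
by case/existsP: (valP e) => x /existsP[y /andP[xy /eqP ->]]; exists x, y.
Qed.

Lemma adj_neq x y : adj x y -> x != y.
Proof. by apply: contraTneq => ->; rewrite adj_irr. Qed.

(* [X] is a switching set: [frustrated sigma X] is the signature [sigma]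
   switched at the vertices of [X]. *)
Definition frustrated sigma X e :=
  sigma e (+) \big[addb/false]_(z in val e) (z \in X).

Lemma frustrated_symdiff sigma X X' e :
  frustrated sigma [set z | (z \in X) (+) (z \in X')] e =
  frustrated sigma X e (+) \big[addb/false]_(z in val e) (z \in X').
Proof.
rewrite /frustrated -addbA -big_split; congr addb.
by apply: eq_bigr => z _; rewrite inE.
Qed.

Lemma parity_pair x y X :
  x != y -> \big[addb/false]_(z in [set x; y]) (z \in X) = (x \in X) (+) (y \in X).
Proof. by move=> neq_xy; rewrite big_setU1 ?inE //= big_set1. Qed.

Lemma neq_edge e x y : val e = [set x; y] -> x != y.
Proof.
case: (edge_adj e) => u [v [/adj_neq uv ->]] /(congr1 (fun A : {set T} => #|A|)).
by rewrite !cards2 uv; case: eqP.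
Qed.

(** * Signs of cycles under switching *)

Definition step_edge c x : {set T} := [set x; next c x].

(** If distinct [x] and [y] shared a step edge, each would be the successor of the other and the
    cycle would close after two steps. *)
Lemma step_inj c : 2 < size c -> uniq c -> {in c &, injective (step_edge c)}.
Proof.
move=> c_gt2 Uc x y xc yc eq_xy; apply/eqP/negPn/negP => neq_xy.
have /set2P[/eqP|def_x] : x \in step_edge c y by rewrite -eq_xy set21.
  by rewrite (negPf neq_xy).
have /set2P[/eqP|def_y] : y \in step_edge c x by rewrite eq_xy set21.
  by rewrite eq_sym (negPf neq_xy).
(* Rotating [c] to start at [x] makes [next] explicit; a third vertex then gives the
   contradiction. *)
have [i s def_s] := rot_to xc; move: c_gt2 Uc neq_xy def_x def_y.
rewrite -(size_rot i) -[uniq c](rot_uniq i) => c_gt2 Uc.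
rewrite -(next_rot i (p := c)) -1?(rot_uniq i) //.
rewrite -[next c x](next_rot i) -1?(rot_uniq i) //.
rewrite {}def_s in Uc c_gt2 *.
case: s => [|a [|b s]] //= in Uc c_gt2 *; rewrite eqxx => neq_xy /[swap] ->.
move: Uc; rewrite !inE !negb_or -!andbA => /and4P[xa xb _ _].
by rewrite [a == x]eq_sym (negPf xa) eqxx => /eqP; rewrite (negPf xb).
Qed.

Lemma cycle_stepE c x : is_cycle adj c -> x \in c ->
  exists2 e : edge adj, e \in cycle_edges adj c & val e = step_edge c x.
Proof.
case/andP=> _ /andP[cyc _] xc; have [e def_e] := adj_edge (next_cycle cyc xc).
by exists e; rewrite // inE def_e; apply: map_f.
Qed.

Lemma prod_cycle_edges c (G : {set T} -> int) : is_cycle adj c ->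
  (\prod_(e in cycle_edges adj c) G (val e) = \prod_(x <- c) G (step_edge c x))%R.
Proof.
move=> cyc; have /andP[c_gt2 /andP[_ Uc]] := cyc.
rewrite -(big_imset G (h := val)); last by move=> e f _ _; apply: val_inj.
rewrite -(big_map (step_edge c) xpredT G) big_uniq /=; last first.
  by rewrite map_inj_in_uniq //; apply: step_inj.
apply: eq_bigl => A; apply/imsetP/mapP => [[e] | [x xc ->]].
  by rewrite inE => /mapP[x xc def_e] ->; exists x.
by have [e e_c def_e] := cycle_stepE cyc xc; exists e.
Qed.

Lemma perm_next c : uniq c -> perm_eq (map (next c) c) c.
Proof.
move=> Uc; apply: uniq_perm => //.
  by rewrite map_inj_uniq //; apply: can_inj (prev_next Uc).
move=> x; apply/mapP/idP => [[y yc ->] | xc]; first by rewrite mem_next.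
by exists (prev c x); rewrite ?mem_prev ?next_prev.
Qed.

(** Every vertex of the cycle ends two of its edges, one entering and one leaving, so its switching
    factor occurs squared. *)
Lemma cycle_sign_switch sigma X c : is_cycle adj c ->
  (cycle_sign sigma c =
   \prod_(e in cycle_edges adj c) (-1) ^+ frustrated sigma X e)%R.
Proof.
move=> cyc; rewrite (eq_bigr _ (fun e _ => signr_addb _ _ _)) big_split /=.
rewrite (@prod_cycle_edges _
  (fun A => (-1) ^+ (\big[addb/false]_(z in A) (z \in X)))%R) //.
have /andP[_ /andP[adj_c Uc]] := cyc.
rewrite (eq_big_seq (fun x => (-1) ^+ (x \in X) * (-1) ^+ (next c x \in X))%R).
  rewrite big_split /= -(big_map (next c) xpredT (fun x => (-1) ^+ (x \in X))%R).
  rewrite (perm_big _ (perm_next Uc)) -big_split.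
  rewrite [X in (_ * X)%R]big1 ?mulr1 //= => x _.
  by rewrite -signr_addb addbb.
move=> x xc; rewrite parity_pair ?signr_addb //.
exact/adj_neq/(next_cycle adj_c).
Qed.

Lemma unfrustrated_balanced sigma X S F :
  {in F, forall e, ~~ frustrated sigma X e} -> balanced sigma S F.
Proof.
move=> FX; apply/balancedP => c cyc _ /subsetP cF.
by rewrite (cycle_sign_switch _ X) // big1 // => e /cF/FX/negPf->.
Qed.

(* Harary: a balanced signed graph can be switched to be all positive.  Edges
   are added one by one: an edge joining two components is corrected by
   switching one of them, any other edge closes a cycle. *)
Lemma balanced_unfrustrated sigma S F :
  {in F, forall e, val e \subset S} -> balanced sigma S F ->
  exists X, {in F, forall e, ~~ frustrated sigma X e}.
Proof.
elim: {F}_.+1 {-2}F (ltnSn #|F|) => // n IHn F leFn FS bal.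
have [->|[e0 e0F]] := set_0Vmem F; first by exists set0 => e; rewrite inE.
pose F' := F :\ e0.
have sF'F : F' \subset F by apply: subD1set.
have [|e /(subsetP sF'F)/FS //||X FX] := IHn F'.
- by rewrite (cardsD1 e0) e0F in leFn.
- apply/balancedP => c cyc cS /subset_trans/(_ sF'F) cF.
  by move/balancedP: bal; apply.
(* Only [e0] can still be frustrated. *)
have FXE e : e \in F -> frustrated sigma X e -> e = e0.
  move=> eF; apply: contraTeq => neq_e; apply: FX.
  by rewrite !inE neq_e.
have [x [y [xy def_e0]]] := edge_adj e0.
pose r u v := [set u; v] \in [set val e | e in F'].
have sym_r : symmetric r by move=> u v; rewrite /r setUC.
have r_adj : subrel r adj.
  move=> u v /imsetP[e _ def_e]; have [u' [v' [uv' def_e']]] := edge_adj e.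
  have neq_uv := neq_edge (esym def_e); move: def_e neq_uv; rewrite def_e'.
  move=> eq_uv; have: u \in [set u'; v'] by rewrite -eq_uv set21.
  have: v \in [set u'; v'] by rewrite -eq_uv set22.
  by case/set2P=> -> /set2P[]->; rewrite ?eqxx // adj_sym.
have [/connectP[p] | not_xy] := boolP (connect r x y).
  (* A simple path from [x] to [y] in [F'], closed by [e0], is a cycle whose only possibly
     frustrated edge is [e0]; its positive sign forces [e0] to be unfrustrated. *)
  case/shortenP=> q rq Uq _ def_y; exists X => e eF; apply/negP => fr_e.
  have {fr_e eF e} fr0 : frustrated sigma X e0.
    by have <- := FXE e eF fr_e.
  case/lastP: q => [|q z] in rq Uq def_y *.
    by rewrite def_y /= adj_irr in xy.
  rewrite last_rcons in def_y; rewrite -{z}def_y in rq Uq *.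
  pose c := [:: y, x & q].
  have cyc_r : cycle (fun u v => [set u; v] \in [set val e | e in F]) c.
    rewrite /= setUC -def_e0 imset_f //=.
    apply: sub_path rq => u v; exact/subsetP/imsetS.
  have cyc : is_cycle adj c.
    apply/and3P; split.
    (* An empty [q] would make the edge [xy] a member of [F'], which omits [e0]. *)
    - rewrite /c; case: (q) rq => //=.
      rewrite andbT /r -def_e0 mem_imset; last exact: val_inj.
      by rewrite !inE eqxx.
    - by rewrite /= adj_sym xy; apply: sub_path rq.
    - by rewrite -rcons_cons rcons_uniq in Uq.
  have e0c : e0 \in cycle_edges adj c.
    by rewrite inE /= eqxx def_e0 setUC mem_head.
  have cF : cycle_edges adj c \subset F.
    apply/subsetP => e; rewrite inE => /mapP[u /(next_cycle cyc_r)].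
    by move=> /imsetP[f fF ->] /val_inj->.
  have sign_c : cycle_sign sigma c = 1%R.
    move/balancedP: bal => -> // u uc.
    have /imsetP[f /FS/subsetP fS def_f] := next_cycle cyc_r uc.
    by apply: fS; rewrite -def_f set21.
  move: sign_c; rewrite (cycle_sign_switch _ X) // (bigD1 e0) //= fr0.
  rewrite big1 // => e /andP[/(subsetP cF) eF].
  by case fr_e: (frustrated sigma X e) => //; rewrite (FXE e eF fr_e) eqxx.
have [fr0 | nfr0] := boolP (frustrated sigma X e0); last first.
  by exists X => e eF; apply/negP => /[dup] /(FXE _ eF) ->; apply/negP.
(* Switching the component [C] of [x] corrects [e0], and no edge of [F'] leaves [C]. *)
pose C := [set u | connect r x u].
exists [set z | (z \in X) (+) (z \in C)] => e eF; rewrite frustrated_symdiff.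
have [-> | neq_e] := eqVneq e e0.
  by rewrite fr0 def_e0 parity_pair ?(adj_neq xy) // !inE connect0 (negPf not_xy).
have eF' : e \in F' by rewrite !inE neq_e.
have [u [v [uv def_e]]] := edge_adj e.
rewrite (negPf (FX e eF')) def_e parity_pair ?(adj_neq uv) // !inE /=.
have r_uv : r u v by rewrite /r -def_e imset_f.
suff -> : connect r x u = connect r x v by rewrite addbb.
exact: (same_connect_r (sym_connect_sym sym_r) (connect1 r_uv) x).
Qed.

(** * Frustration index and frustration number *)

Lemma frustration_index_le sigma D :
  balanced_del_edges sigma D -> frustration_index sigma <= #|D|.
Proof.
move=> balD; rewrite /frustration_index.
by case: arg_minnP => [|A _]; [apply: balanced_del_all_edges | apply].
Qed.

Lemma frustration_indexP sigma :
  exists2 D, balanced_del_edges sigma D & #|D| = frustration_index sigma.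
Proof.
rewrite /frustration_index; case: arg_minnP => [|D balD _].
  exact: balanced_del_all_edges.
by exists D.
Qed.

Lemma frustration_number_le sigma W :
  balanced_del_vertices sigma W -> frustration_number sigma <= #|W|.
Proof.
move=> balW; rewrite /frustration_number.
by case: arg_minnP => [|A _]; [apply: balanced_del_all_vertices | apply].
Qed.

Lemma frustration_numberP sigma :
  exists2 W, balanced_del_vertices sigma W & #|W| = frustration_number sigma.
Proof.
rewrite /frustration_number; case: arg_minnP => [|W balW _].
  exact: balanced_del_all_vertices.
by exists W.
Qed.

Lemma frustration_index_le_frustrated sigma X :
  frustration_index sigma <= #|[set e | frustrated sigma X e]|.
Proof.
apply: frustration_index_le; apply: (@unfrustrated_balanced _ X) => e.
by rewrite !inE.
Qed.

Lemma frustration_index_le_negative sigma :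
  frustration_index sigma <= #|negative_edges sigma|.
Proof.
apply: leq_trans (frustration_index_le_frustrated sigma set0) _.
apply: subset_leq_card; apply/subsetP => e; rewrite !inE /frustrated.
by rewrite big1 ?addbF // => z _; rewrite inE.
Qed.

Lemma frustration_number_le_index sigma :
  frustration_number sigma <= frustration_index sigma.
Proof.
have [D balD <-] := frustration_indexP sigma.
(* [W] holds one chosen end of each edge of [D]; the choice is option-valued, so cardinalities are
   compared through [Some]. *)
pose W := [set x | Some x \in [set [pick y in val e] | e : edge adj in D]].
apply: leq_trans (leq_imset_card (fun e : edge adj => [pick y in val e]) D).
apply: (@leq_trans #|W|); last first.
  rewrite -(card_imset W (@Some_inj _ : injective (@Some T))); apply: subset_leq_card.
  by apply/subsetP => y /imsetP[x xW ->]; rewrite inE in xW.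
apply/frustration_number_le/balancedP => c cyc _ /subsetP cW.
move/balancedP: balD; apply=> //; first by move=> x; rewrite inE.
apply/subsetP => e /cW; rewrite !inE; apply: contraTN => eD.
apply/subsetPn; have [x [y [_ def_e]]] := edge_adj e.
case def_z: [pick z in val e] => [z|]; last first.
  by case: pickP def_z => // /(_ x); rewrite def_e set21.
have ze : z \in val e by case: pickP def_z => // t te [<-].
by exists z; rewrite // !inE negbK -def_z imset_f.
Qed.

Lemma frustrated_flip sigma X w e :
  frustrated sigma [set z | (z \in X) (+) (z \in [set w])] e =
  frustrated sigma X e (+) (w \in val e).
Proof.
rewrite frustrated_symdiff; congr addb.
have [x [y [xy ->]]] := edge_adj e.
rewrite parity_pair ?(adj_neq xy) // !inE ![w == _]eq_sym.
by case: eqP => // <-; rewrite eq_sym (negPf (adj_neq xy)).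
Qed.

Lemma frustration_index_le_number sigma :
  (forall x, #|[set e : edge adj | x \in val e]| <= 3) ->
  frustration_index sigma <= frustration_number sigma.
Proof.
move=> max_deg; have [W balW <-] := frustration_numberP sigma.
(* The minimum is taken over all switchings that make every edge avoiding [W] positive; this family
   is closed under switching vertices of [W]. *)
pose ok X := [forall e : edge adj,
  (val e \subset ~: W) ==> ~~ frustrated sigma X e].
have [X0 okX0] : exists X, ok X.
  have [|X FX] := balanced_unfrustrated _ balW; first by move=> e; rewrite inE.
  exists X; apply/forallP => e; apply/implyP => eW.
  by apply: FX; rewrite inE.
pose fr X := [set e | frustrated sigma X e].
have [X okX minX] := @arg_minnP _ X0 ok (fun X => #|fr X|) okX0.
apply: leq_trans (frustration_index_le_frustrated sigma X) _; rewrite -/(fr X).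
have fr1 w : w \in W -> #|[set e : edge adj | w \in val e] :&: fr X| <= 1.
  move=> wW; set A := [set e | _]; set X' := [set z | (z \in X) (+) (z \in [set w])].
  have frX' : fr X' = (fr X :\: A) :|: (A :\: fr X).
    apply/setP => e; rewrite !inE frustrated_flip.
    by case: frustrated; case: (w \in _).
  have okX' : ok X'.
    apply/forallP => e; apply/implyP => eW; rewrite frustrated_flip.
    move/forallP/(_ e): okX; rewrite eW; case: (boolP (w \in val e)) =>
      [/(subsetP eW)|].
      by rewrite inE wW.
    by rewrite addbF.
  (* By minimality at most half of the edges at [w] are frustrated; as there are at most 3 edges, at
     most 1 is. *)
  have := minX X' okX'; rewrite frX' => /leq_trans/(_ (leq_card_setU _ _)).
  rewrite -(cardsID A (fr X)) addnC leq_add2l setIC.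
  have := max_deg w; rewrite -/A -(cardsID (fr X) A).
  case: #|A :&: _| => [|[|m]] //; case: #|_ :\: _| => [|[|k]] //.
  by rewrite ?addnS ?addSn.
have /subset_leq_card : fr X \subset
    \bigcup_(w in W) ([set e : edge adj | w \in val e] :&: fr X).
  apply/subsetP => e frE; have /forallP/(_ e) := okX.
  rewrite inE in frE; rewrite frE implybF => /subsetPn[w we]; rewrite inE negbK => wW.
  by apply/bigcupP; exists w => //; rewrite !inE we.
move/leq_trans; apply; rewrite -[#|W|]sum1_card.
apply: (@leq_trans (\sum_(w in W) #|[set e : edge adj | w \in val e] :&: fr X|)).
  elim/big_rec2: _ => [|w n B _ leB]; first by rewrite cards0.
  by apply: leq_trans (leq_card_setU _ _) _; rewrite leq_add2l.
exact: leq_sum.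
Qed.

(* A balancing edge set meets every negative cycle. *)
Lemma negative_cycle_packing sigma (cs : seq (seq T)) k :
  {in cs, forall c, is_cycle adj c && (cycle_sign sigma c != 1%R)} ->
  (forall e, count (fun c => e \in cycle_edges adj c) cs <= k) ->
  size cs <= k * frustration_index sigma.
Proof.
move=> neg_cs le_k; have [D balD <-] := frustration_indexP sigma.
(* Double counting of incidences: each cycle has an edge in [D], and each edge of [D] is on at most
   [k] of the cycles. *)
apply: (@leq_trans (\sum_(c <- cs) \sum_(e in D) (e \in cycle_edges adj c))).
  rewrite -sum1_size big_seq [leqRHS]big_seq; apply: leq_sum => c /neg_cs/andP[cyc].
  rewrite lt0n; apply: contraNneq => /eqP; rewrite sum_nat_eq0 => /forall_inP D0.
  apply/eqP; move/balancedP: balD; apply=> // [x|]; first by rewrite inE.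
  apply/subsetP => e ec; rewrite inE; apply/negP => /D0.
  by rewrite ec.
rewrite exchange_big mulnC -sum_nat_const; apply: leq_sum => e _.
by rewrite (leq_trans _ (le_k e)) // -sum1_count [leqRHS]big_mkcond.
Qed.

End SignedGraph.

(** * The Petersen graph *)

(* The vertices are numbered 0 to 9 so that the finite checks below reduce by
   computation; [code i] lists the two elements of the [i]-th pair. *)
Definition code (i : 'I_10) : 'I_5 * 'I_5 :=
  let p := nth (0, 1) [:: (0, 1); (0, 2); (0, 3); (0, 4); (1, 2);
                          (1, 3); (1, 4); (2, 3); (2, 4); (3, 4)] i in
  (inZp p.1, inZp p.2).

Definition indices : seq 'I_10 := [seq inZp i | i <- iota 0 10].

Lemma mem_indices i : i \in indices.
Proof. by case: i => i; do 10?[case: i => [|i] //]. Qed.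

Lemma card_code i : #|[set (code i).1; (code i).2]| == 2.
Proof.
rewrite cards2 eqSS eqb1.
by have /allP/(_ i (mem_indices i)) :
  all (fun i => (code i).1 != (code i).2) indices.
Qed.

Definition vtx i : petersen_vertex :=
  Sub [set (code i).1; (code i).2] (card_code i).

Lemma vtx_surj v : exists i, v = vtx i.
Proof.
have /cards2P[x [y [neq_xy def_v]]] := valP v.
have /hasP[i _ /pred2P def_xy] :
    has (fun i => pred2 (x, y) (y, x) (code i)) indices.
  by move: x y neq_xy {def_v} => [[|[|[|[|[|?]]]]] ?] [[|[|[|[|[|?]]]]] ?].
exists i; apply: val_inj; rewrite SubK def_v.
by case: def_xy => ->; rewrite // setUC.
Qed.

Definition adj10 : rel 'I_10 := fun i j =>
  [&& (code i).1 != (code j).1, (code i).1 != (code j).2,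
      (code i).2 != (code j).1 & (code i).2 != (code j).2].

Lemma petersen_vtx i j : petersen (vtx i) (vtx j) = adj10 i j.
Proof.
by rewrite /petersen !SubK disjoints_subset subUset !sub1set !inE !negb_or -andbA.
Qed.

(** Distinct indices have distinct neighbourhoods, which is a finite check on [adj10]. *)
Lemma vtx_inj : injective vtx.
Proof.
move=> i j eq_ij; have eq_adj k : adj10 i k = adj10 j k.
  by rewrite -!petersen_vtx eq_ij.
have /allP/(_ i (mem_indices i))/allP/(_ j (mem_indices j)) :
    all (fun i => all (fun j =>
      all (fun k => adj10 i k == adj10 j k) indices ==> (i == j)) indices) indices.
  by vm_compute.
by case: allP => [_ /eqP|[]] // k _; apply/eqP.
Qed.

Lemma petersen_sym : symmetric petersen.
Proof. by move=> u v; rewrite /petersen disjoint_sym. Qed.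

Lemma petersen_irr : irreflexive petersen.
Proof.
by move=> v; rewrite /petersen -setI_eq0 setIid -cards_eq0 (eqP (valP v)).
Qed.

(** * Edges of the Petersen graph as pairs of indices *)

Lemma set2_eq (T : finType) (a b c d : T) :
  ([set a; b] == [set c; d]) = pred2 (c, d) (d, c) (a, b).
Proof.
apply/eqP/pred2P => [/setP eq_ab | [][-> ->] //]; last by rewrite setUC.
move: (eq_ab a) (eq_ab b) (eq_ab c) (eq_ab d); rewrite !inE !eqxx ?orbT /=.
do 2!case/esym/pred2P=> ->; rewrite ?eqxx ?orbT ?orbb; auto.
  by move=> _ /eqP->; left.
by move=> /eqP->; left.
Qed.

Definition pair_set (p : 'I_10 * 'I_10) : {set petersen_vertex} :=
  [set vtx p.1; vtx p.2].

Definition same_edge (p q : 'I_10 * 'I_10) := pred2 q (q.2, q.1) p.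

Lemma pair_set_eq p q : (pair_set p == pair_set q) = same_edge p q.
Proof.
case: p q => [i j] [k l]; rewrite set2_eq /same_edge /= !xpair_eqE.
by rewrite !(inj_eq vtx_inj).
Qed.

(** Each edge occurs twice, once in each orientation. *)
Definition edges10 :=
  [seq p <- [seq (i, j) | i <- indices, j <- indices] | adj10 p.1 p.2].

Lemma edge_pair (e : edge petersen) : exists2 p, p \in edges10 & val e = pair_set p.
Proof.
have [u [v [uv ->]]] := edge_adj e; move: uv.
have [[i ->] [j ->]] := (vtx_surj u, vtx_surj v); rewrite petersen_vtx => ij.
by exists (i, j); rewrite // mem_filter ij allpairs_f ?mem_indices.
Qed.

Lemma petersen_degree v : #|[set e : edge petersen | v \in val e]| <= 3.
Proof.
have [i ->] := vtx_surj v; set A := [set e | _].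
pose s := [seq pair_set (i, j) | j <- indices & adj10 i j].
have le_s : #|A| <= size s.
  rewrite -(card_imset A val_inj).
  apply: leq_trans (card_size s); apply: subset_leq_card; apply/subsetP => B /imsetP[e].
  rewrite inE => ie ->{B}; apply/mapP.
  have [[j k] + def_e] := edge_pair e.
  rewrite mem_filter => /andP[jk _].
  move: ie; rewrite def_e => /set2P[] /vtx_inj ->.
    by exists k; first by rewrite mem_filter jk mem_indices.
  exists j; last by rewrite /pair_set setUC.
  by rewrite mem_filter mem_indices -petersen_vtx petersen_sym petersen_vtx jk.
apply: leq_trans le_s _; rewrite size_map.
have /allP/(_ i (mem_indices i)) // :
  all (fun i => size [seq j <- indices | adj10 i j] <= 3) indices.
by vm_compute.
Qed.

Lemma petersen_frustration_number_index (sigma : signature petersen) :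
  frustration_number sigma = frustration_index sigma.
Proof.
apply/eqP; rewrite eqn_leq frustration_number_le_index.
exact: (frustration_index_le_number petersen_sym petersen_irr _ petersen_degree).
Qed.

(** * Pentagons, hexagons and certificates for the lower bound *)

Definition cycle_pairs (c : seq 'I_10) := [seq (x, next c x) | x <- c].

Definition mem_edge p s := has (same_edge p) s.

Definition negative (l : seq ('I_10 * 'I_10)) c :=
  odd (count (fun p => mem_edge p l) (cycle_pairs c)).

(** Each pentagon is listed once, with one starting vertex and one direction. *)
Definition pentagons : seq (seq 'I_10) := map (map inZp) [::
  [:: 0; 7; 3; 4; 9]; [:: 0; 7; 3; 5; 8]; [:: 0; 7; 6; 1; 9];
  [:: 0; 7; 6; 2; 8]; [:: 0; 8; 2; 4; 9]; [:: 0; 8; 5; 1; 9];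
  [:: 1; 5; 3; 4; 9]; [:: 1; 5; 3; 7; 6]; [:: 1; 5; 8; 2; 6];
  [:: 1; 6; 2; 4; 9]; [:: 2; 4; 3; 5; 8]; [:: 2; 4; 3; 7; 6]].

Definition hexagons : seq (seq 'I_10) := map (map inZp) [::
  [:: 0; 7; 3; 4; 2; 8]; [:: 0; 7; 3; 5; 1; 9]; [:: 0; 7; 6; 1; 5; 8];
  [:: 0; 7; 6; 2; 4; 9]; [:: 0; 8; 2; 6; 1; 9]; [:: 0; 8; 5; 3; 4; 9];
  [:: 1; 5; 3; 4; 2; 6]; [:: 1; 5; 8; 2; 4; 9]; [:: 1; 6; 7; 3; 4; 9];
  [:: 2; 6; 7; 3; 5; 8]].

Lemma cycle_edges_vtx c p (e : edge petersen) : uniq c -> val e = pair_set p ->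
  (e \in cycle_edges petersen (map vtx c)) = mem_edge p (cycle_pairs c).
Proof.
move=> Uc def_e; rewrite inE def_e -map_comp.
apply/mapP/hasP => [[x xc /eqP] | [_ /mapP[x xc ->]]].
  rewrite /= next_map //; last exact: vtx_inj.
  rewrite (pair_set_eq p (x, next c x)) => eq_p.
  by exists (x, next c x); first exact: map_f.
rewrite -pair_set_eq => /eqP ->; exists x => //=.
by rewrite next_map //; apply: vtx_inj.
Qed.

Definition presents l (sigma : signature petersen) :=
  [set val e | e in negative_edges sigma] = [set A in map pair_set l].

Lemma mem_presents l sigma (e : edge petersen) p :
  presents l sigma -> val e = pair_set p -> sigma e = mem_edge p l.
Proof.
move=> /setP/(_ (val e)) + def_e; rewrite mem_imset ?inE; last exact: val_inj.
move=> ->; rewrite def_e; apply/mapP/hasP => [[q ql /eqP] | [q ql]].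
  by rewrite pair_set_eq; exists q.
by rewrite -pair_set_eq => /eqP; exists q.
Qed.

Definition good_cycle c := [&& 2 < size c, cycle adj10 c & uniq c].

Lemma is_cycle_vtx c : good_cycle c -> is_cycle petersen (map vtx c).
Proof.
case/and3P=> c_gt2 cyc Uc.
rewrite /is_cycle size_map c_gt2 /ucycleb map_inj_uniq ?Uc; last exact: vtx_inj.
by rewrite cycle_map andbT /=; apply: sub_cycle cyc => i j; rewrite /= petersen_vtx.
Qed.

Lemma cycle_sign_vtx l sigma c : presents l sigma -> good_cycle c ->
  cycle_sign sigma (map vtx c) = ((-1) ^+ negative l c)%R.
Proof.
move=> pres good_c; have /and3P[_ _ Uc] := good_c.
(* The sign is rewritten as a function of the underlying vertex pair, the form that
   [prod_cycle_edges] handles. *)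
pose G (A : {set petersen_vertex}) : int :=
  ((-1) ^+ (A \in [set val e | e in negative_edges sigma]))%R.
transitivity (\prod_(e in cycle_edges petersen (map vtx c)) G (val e))%R.
  apply: eq_bigr => e _; rewrite /G mem_imset ?inE //; exact: val_inj.
rewrite prod_cycle_edges ?is_cycle_vtx // big_map.
rewrite /negative /cycle_pairs count_map signr_odd.
(* The induction is on the list of starting points only; the cycle inside [next] stays fixed. *)
elim: {1 4}c => [|x s IHs]; first by rewrite big_nil.
rewrite big_cons IHs /= exprD; congr (_ * _)%R.
rewrite /G /step_edge next_map //; last exact: vtx_inj.
congr (_ ^+ _)%R; rewrite pres inE; congr nat_of_bool.
apply/mapP/hasP => [[q ql /eqP] | [q ql]].
  by rewrite (pair_set_eq (x, next c x)); exists q.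
by rewrite -pair_set_eq => /eqP; exists q.
Qed.

(** An edge lies on at most 4 cycles of either family, so fewer than [size l] edges cannot meet more
    than [4 * (size l).-1] negative ones. *)
Definition certified l :=
  has (fun m => 4 * (size l).-1 < count (negative l) m) [:: pentagons; hexagons].

Lemma good_cycles m : m \in [:: pentagons; hexagons] -> all good_cycle m.
Proof. by apply/allP; vm_compute. Qed.

Lemma cycles_through m p : m \in [:: pentagons; hexagons] -> p \in edges10 ->
  count (fun c => mem_edge p (cycle_pairs c)) m <= 4.
Proof.
move=> m_in p_in; have /allP/(_ m m_in)/allP/(_ p p_in) // :
  all (fun m => all (fun p =>
    count (fun c => mem_edge p (cycle_pairs c)) m <= 4) edges10)
    [:: pentagons; hexagons].
by vm_compute.
Qed.

(** Deleting the listed edges gives the upper bound; packing the negative cycles of the certifying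
    family gives the lower one. *)
Lemma frustration_number_certified l sigma :
  presents l sigma -> certified l -> frustration_number sigma = size l.
Proof.
move=> pres /hasP[m m_in cert]; rewrite petersen_frustration_number_index; apply/eqP.
rewrite eqn_leq; apply/andP; split.
  apply: leq_trans (frustration_index_le_negative petersen_irr sigma) _.
  rewrite -(card_imset _ val_inj) pres cardsE -(size_map pair_set).
  exact: card_size.
suff : size [seq c <- m | negative l c] <= 4 * frustration_index sigma.
  rewrite size_filter => /(leq_trans cert).
  by rewrite ltn_pmul2l //; case: (size l).
rewrite -(size_map (map vtx)); have /allP good_m := good_cycles m_in.
apply: negative_cycle_packing => [_ /mapP[c + ->] | e].
  rewrite mem_filter => /andP[neg_c /good_m good_c].
  by rewrite is_cycle_vtx // (cycle_sign_vtx pres good_c) neg_c.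
have [p p_in def_e] := edge_pair e.
rewrite count_map count_filter; apply: leq_trans (cycles_through m_in p_in).
rewrite -size_filter -[leqRHS]size_filter.
have -> : [seq c <- m | mem_edge p (cycle_pairs c)]
        = [seq c <- m | e \in cycle_edges petersen (map vtx c)].
  apply: eq_in_filter => c /good_m/and3P[_ _ Uc].
  by rewrite (cycle_edges_vtx Uc def_e).
by rewrite !size_filter; apply: sub_count => c /andP[].
Qed.

(** * Frustration numbers of the six signed graphs *)

Lemma frustration_number_all_positive : frustration_number all_positive = 0.
Proof.
rewrite petersen_frustration_number_index; apply/eqP; rewrite -leqn0.
apply: leq_trans (frustration_index_le_negative petersen_irr _) _.
by rewrite leqn0 cards_eq0; apply/eqP/setP => e; rewrite !inE.
Qed.

Lemma frustration_number_P1 sigma : is_P1 sigma -> frustration_number sigma = 1.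
Proof.
case/eqP/cards1P=> e neg_e; have [p p_in def_e] := edge_pair e.
apply: (@frustration_number_certified [:: p]).
  by rewrite /presents neg_e imset_set1 def_e; apply/setP => A; rewrite !inE.
by have /allP/(_ p p_in) : all (fun p => certified [:: p]) edges10 by vm_compute.
Qed.

Lemma graph_dist_path (T : finType) (r : rel T) x y n (p : n.-tuple T) :
  n < graph_dist r x y -> path r x p -> last x p != y.
Proof.
move=> lt_n rp; have lt_nT : n < #|T|.
  (* [find] never exceeds the length [#|T|] of the list it searches. *)
  by apply: leq_trans lt_n _; rewrite -[leqRHS](size_iota 0) find_size.
move: (before_find 0 lt_n); rewrite nth_iota // => /existsP noP.
by apply/negP => xp_y; case: noP; exists p; rewrite rp.
Qed.

(** For edges this also excludes a common vertex, since the other end of [p] is adjacent to it. *)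
Definition far_pairs (p q : 'I_10 * 'I_10) :=
  ~~ has (fun i => has (adj10 i) [:: q.1; q.2]) [:: p.1; p.2].

Definition disjoint_pairs (p q : 'I_10 * 'I_10) :=
  ~~ has (mem [:: q.1; q.2]) [:: p.1; p.2].

Lemma edge_dist_disjoint (e f : edge petersen) p q :
  val e = pair_set p -> val f = pair_set q -> e != f -> 1 < edge_dist e f ->
  disjoint_pairs p q.
Proof.
move=> def_e def_f neq_ef dist_ef; apply/hasPn => i ip; apply/negP => /= iq.
have /(_ [tuple f] dist_ef)/= := @graph_dist_path _ (@line_adj _ petersen) e f 1.
rewrite eqxx andbT /line_adj neq_ef => /(_ _)/negP[] //.
apply/set0Pn; exists (vtx i); rewrite inE def_e def_f !inE !(inj_eq vtx_inj).
by move: ip iq; rewrite !inE => -> ->.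
Qed.

(** An edge [g] joining an end of [e] to an end of [f] would give the path [e], [g], [f] of length 2
    in the line graph. *)
Lemma edge_dist_far (e f : edge petersen) p q :
  val e = pair_set p -> val f = pair_set q -> e != f -> 2 < edge_dist e f ->
  far_pairs p q.
Proof.
move=> def_e def_f neq_ef dist_ef; apply/hasPn => i ip; apply/hasPn => j jq.
apply/negP; rewrite -petersen_vtx => /adj_edge[g def_g].
have /hasPn dis := edge_dist_disjoint def_e def_f neq_ef (ltnW dist_ef).
have ie : vtx i \in val e.
  by rewrite def_e !inE !(inj_eq vtx_inj); move: ip; rewrite !inE.
have jf : vtx j \in val f.
  by rewrite def_f !inE !(inj_eq vtx_inj); move: jq; rewrite !inE.
have i_f : vtx i \notin val f.
  by have := dis i ip; rewrite def_f !inE !(inj_eq vtx_inj).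
have j_e : vtx j \notin val e.
  rewrite def_e !inE !(inj_eq vtx_inj); apply/negP => jp.
  by have := dis j; move: jq; rewrite /= !inE jp => -> /(_ isT).
have /(_ [tuple g; f] dist_ef)/= := @graph_dist_path _ (@line_adj _ petersen) e f 2.
rewrite eqxx andbT /line_adj => /(_ _)/negP[] //; apply/and3P; split=> //.
- apply/andP; split; first by apply: contraNneq j_e => ->; rewrite def_g set22.
  by apply/set0Pn; exists (vtx i); rewrite inE ie def_g set21.
- by apply: contraNneq i_f => <-; rewrite def_g set21.
by apply/set0Pn; exists (vtx j); rewrite inE jf def_g set22.
Qed.

(** Both distances reduce to disjointness: two disjoint negative edges give 6 or 8 negative
    pentagons, more than the 4 that one edge can meet. *)
Lemma frustration_number_P2 d sigma :
  1 < d -> is_P2 d sigma -> frustration_number sigma = 2.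
Proof.
move=> d_gt1 [e [f [neq_ef neg_ef dist_ef]]].
have [[p p_in def_e] [q q_in def_f]] := (edge_pair e, edge_pair f).
apply: (@frustration_number_certified [:: p; q]).
  rewrite /presents neg_ef imsetU1 imset_set1 def_e def_f.
  by apply/setP => A; rewrite !inE.
rewrite -dist_ef in d_gt1.
have := edge_dist_disjoint def_e def_f neq_ef d_gt1.
apply/implyP; have /allP/(_ p p_in)/allP/(_ q q_in) // :
  all (fun p => all (fun q => disjoint_pairs p q ==> certified [:: p; q]) edges10)
    edges10.
by vm_compute.
Qed.

Lemma frustration_number_P33 sigma : is_P33 sigma -> frustration_number sigma = 3.
Proof.
case=> card_neg dist3.
have [e [f [g [neq_ef neq_eg neq_fg neg_efg]]]] : exists e f g,
    [/\ e != f, e != g, f != g & negative_edges sigma = [set e; f; g]].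
  have := card_neg; rewrite cardE; have := enum_uniq (negative_edges sigma).
  case def_s: (enum _) => [|e [|f [|g []]]] //=; rewrite !inE !negb_or andbT.
  case/andP=> /andP[ef eg] fg _; exists e, f, g; split=> //.
  by apply/setP => h; rewrite -mem_enum def_s !inE orbA.
have [p p_in def_e] := edge_pair e; have [q q_in def_f] := edge_pair f.
have [r r_in def_g] := edge_pair g.
apply: (@frustration_number_certified [:: p; q; r]).
  rewrite /presents neg_efg !imsetU !imset_set1 def_e def_f def_g.
  by apply/setP => A; rewrite !inE orbA.
have [eN fN gN] : [/\ e \in negative_edges sigma, f \in negative_edges sigma
    & g \in negative_edges sigma] by rewrite neg_efg !inE !eqxx ?orbT.
have far_pq : far_pairs p q by apply: edge_dist_far def_e def_f _ _; rewrite ?dist3.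
have far_pr : far_pairs p r by apply: edge_dist_far def_e def_g _ _; rewrite ?dist3.
have far_qr : far_pairs q r by apply: edge_dist_far def_f def_g _ _; rewrite ?dist3.
move/and3P: (And3 far_pq far_pr far_qr); apply/implyP.
(* Filtering the inner ranges by [far_pairs] keeps the enumeration of triples small. *)
have /allP/(_ p p_in)/allP/(_ q _)/allP/(_ r _) // :
  all (fun p =>
    all (fun q =>
      all (fun r => [&& far_pairs p q, far_pairs p r & far_pairs q r]
                    ==> certified [:: p; q; r])
        [seq r <- edges10 | far_pairs p r])
      [seq q <- edges10 | far_pairs p q]) edges10.
  by vm_compute.
by apply; rewrite mem_filter ?far_pq ?far_pr.
Qed.

Lemma frustration_number_P32 sigma : is_P32 sigma -> frustration_number sigma = 3.
Proof.
case=> [v0 [v1 [v2 [v3 [v4 [v5 [/andP[_ /andP[cyc Uc]] neg_eq]]]]]]].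
have [i0 def0] := vtx_surj v0; have [i1 def1] := vtx_surj v1.
have [i2 def2] := vtx_surj v2; have [i3 def3] := vtx_surj v3.
have [i4 def4] := vtx_surj v4; have [i5 def5] := vtx_surj v5.
subst v0 v1 v2 v3 v4 v5.
apply: (@frustration_number_certified [:: (i0, i1); (i2, i3); (i4, i5)]).
  by rewrite /presents neg_eq; apply/setP => A; rewrite !inE orbA.
rewrite -[X in uniq X]/(map vtx [:: i0; i1; i2; i3; i4; i5]) in Uc.
rewrite (map_inj_uniq vtx_inj) in Uc.
move: cyc; rewrite /= !petersen_vtx andbT => /and5P[a01 a12 a23 a34 /andP[a45 a50]].
pose nbrs i := [seq j <- indices | adj10 i j].
have nbrsP i j : adj10 i j -> j \in nbrs i by rewrite mem_filter mem_indices => ->.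
(* The search follows neighbours instead of all 6-tuples, and the [if] evaluates a certificate only
   on walks that close to a 6-cycle. *)
have : all (fun i0 => all (fun i1 => all (fun i2 => all (fun i3 => all (fun i4 =>
    all (fun i5 =>
      if adj10 i5 i0 && uniq [:: i0; i1; i2; i3; i4; i5]
      then certified [:: (i0, i1); (i2, i3); (i4, i5)] else true)
    (nbrs i4)) (nbrs i3)) (nbrs i2)) (nbrs i1)) (nbrs i0)) indices.
  by vm_compute.
move/allP/(_ _ (mem_indices i0))/allP/(_ _ (nbrsP _ _ a01)).
move/allP/(_ _ (nbrsP _ _ a12))/allP/(_ _ (nbrsP _ _ a23)).
by move/allP/(_ _ (nbrsP _ _ a34))/allP/(_ _ (nbrsP _ _ a45)); rewrite a50 Uc.
Qed.

Theorem theorem7p7 :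
  frustration_number all_positive = 0 /\
  (forall sigma : signature petersen, is_P1 sigma -> frustration_number sigma = 1) /\
  (forall sigma : signature petersen, is_P2 2 sigma -> frustration_number sigma = 2) /\
  (forall sigma : signature petersen, is_P2 3 sigma -> frustration_number sigma = 2) /\
  (forall sigma : signature petersen, is_P32 sigma -> frustration_number sigma = 3) /\
  (forall sigma : signature petersen, is_P33 sigma -> frustration_number sigma = 3) /\
  (forall sigma : signature petersen, frustration_number sigma = frustration_index sigma).
Proof.
split; first exact: frustration_number_all_positive.
split; first exact: frustration_number_P1.
split=> [sigma|]; first exact: frustration_number_P2.
split=> [sigma|]; first exact: frustration_number_P2.
split; first exact: frustration_number_P32.
split; first exact: frustration_number_P33.
exact: petersen_frustration_number_index.
Qed.
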